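(* Consider the sparse linear Gaussian model: $S\in\{1,\dots,N\}$, $\mathcal{X}_S=\{\mathbf{x}\in\mathbb{R}^N:\|\mathbf{x}\|_0\le S\}$, $\sigma>0$, observation $\mathbf{y}=\mathbf{H}\mathbf{x}+\mathbf{n}$, $\mathbf{n}\sim\mathcal{N}(\mathbf{0},\sigma^2\mathbf{I})$, parameter function $g(\mathbf{x})=x_k$ for fixed $k\in[N]$, where $\mathbf{H}\in\mathbb{R}^{M\times N}$ with $M\le N$ satisfies the restricted isometry property of order $S$ with RIP constant $\delta_S<1$. Let $\mathbf{x}_0\in\mathcal{X}_S$ and $\mathcal{K}=\{k_1,\dots,k_{|\mathcal{K}|}\}\subseteq[N]$ with $|\mathcal{K}|\le S$. Let $\mathbf{P}=\mathbf{H}_{\mathcal{K}}(\mathbf{H}_{\mathcal{K}})^{\dagger}$ and $\widetilde{\mathbf{x}}_0$ the unique vector with $\operatorname{supp}(\widetilde{\mathbf{x}}_0)\subseteq\mathcal{K}$ and $\mathbf{H}\widetilde{\mathbf{x}}_0=\mathbf{P}\mathbf{H}\mathbf{x}_0$. Let $c:\mathcal{X}_S\to\mathbb{R}$ be a bias function whose partial derivatives $\frac{\partial c(\mathbf{x})}{\partial x_l}\big|_{\mathbf{x}=\widetilde{\mathbf{x}}_0}$ exist for all $l\in\mathcal{K}$, and let $(\mathbf{b}_{\mathbf{x}_0})_i=\delta_{k,k_i}+\frac{\partial c(\mathbf{x})}{\partial x_{k_i}}\big|_{\mathbf{x}=\widetilde{\mathbf{x}}_0}$, $i\in[|\mathcal{K}|]$.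 Then $$M(c,\mathbf{x}_0)\ \ge\ \exp\Big(-\tfrac{1+\delta_S}{\sigma^2}\big\|\mathbf{x}_0^{\operatorname{supp}(\mathbf{x}_0)\setminus\mathcal{K}}\big\|_2^2\Big)\,\sigma^2\,\mathbf{b}_{\mathbf{x}_0}^T(\mathbf{H}_{\mathcal{K}}^T\mathbf{H}_{\mathcal{K}})^{-1}\mathbf{b}_{\mathbf{x}_0}.$$
   Context: RIP of order $K$ with constant $\delta_K$: $\delta_K$ is the smallest $\delta\ge0$ such that $(1-\delta)\|\mathbf{z}\|_2^2\le\|\mathbf{H}_{\mathcal{I}}\mathbf{z}\|_2^2\le(1+\delta)\|\mathbf{z}\|_2^2$ for all $\mathcal{I}\subseteq[N]$ with $|\mathcal{I}|=K$ and all $\mathbf{z}\in\mathbb{R}^K$. $\mathbf{H}_{\mathcal{K}}$ = columns of $\mathbf{H}$ indexed by $\mathcal{K}$; for an index set $\mathcal{I}$, $\mathbf{x}^{\mathcal{I}}$ is $\mathbf{x}$ with all entries outside $\mathcal{I}$ set to zero; $\dagger$ = pseudoinverse; $\delta_{k,l}$ = Kronecker delta. An estimator $\hat g:\mathbb{R}^M\to\mathbb{R}$ has bias $\mathsf{E}_{\mathbf{x}}\{\hat g(\mathbf{y})\}-x_k$ and variance $v(\hat g;\mathbf{x})$; $M(c,\mathbf{x}_0)$ is the infimum of $v(\hat g;\mathbf{x}_0)$ over estimators with finite variance at $\mathbf{x}_0$ and bias equal to $c$ on all of $\mathcal{X}_S$ ($+\infty$ if none). *)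

(* Defs.v *)
From HB Require Import structures.
From mathcomp Require Import all_boot all_order all_algebra.
From mathcomp Require Import all_classical all_reals all_analysis.
Set Implicit Arguments. Unset Strict Implicit. Unset Printing Implicit Defensive.
Import Order.TTheory GRing.Theory Num.Theory.
Local Open Scope classical_set_scope.
Local Open Scope ring_scope.

Section Defs.
Variable R : realType.

Definition sqnorm n (z : 'cV[R]_n) : R := \sum_(i < n) (z i 0) ^+ 2.

Definition supp n (x : 'cV[R]_n) : {set 'I_n} := [set i | x i 0 != 0].
Definition sparse_set n (S : nat) : set 'cV[R]_n := [set x | (#|supp x| <= S)%N].

Definition subcols m n (H : 'M[R]_(m, n)) (I : {set 'I_n}) : 'M[R]_(m, #|I|) :=
  colsub (@enum_val _ (mem I)) H.

Definition rip_bound m n (H : 'M[R]_(m, n)) (K : nat) (d : R) : Prop :=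
  0 <= d /\
  forall I : {set 'I_n}, #|I| = K -> forall z : 'cV[R]_#|I|,
    (1 - d) * sqnorm z <= sqnorm (subcols H I *m z) <= (1 + d) * sqnorm z.

Definition rip_const m n (H : 'M[R]_(m, n)) (K : nat) (d : R) : Prop :=
  rip_bound H K d /\ forall d', rip_bound H K d' -> d <= d'.

Definition is_pinv m n (A : 'M[R]_(m, n)) (B : 'M[R]_(n, m)) : Prop :=
  [/\ A *m B *m A = A, B *m A *m B = B,
      (A *m B)^T = A *m B & (B *m A)^T = B *m A].

(* Iterated integral against independent Gaussian densities:
   gint sigma [:: m_0; ...; m_(p-1)] f
     = int dt_0 phi_(m_0,sigma)(t_0) ... int dt_(p-1) phi_(m_(p-1),sigma)(t_(p-1))
         f (t_0, ..., t_(p-1), 0, 0, ...). *)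
Definition scons (t : R) (y : nat -> R) : nat -> R :=
  fun i => if i is i'.+1 then y i' else t.

Fixpoint gint (sigma : R) (ms : seq R) (f : (nat -> R) -> \bar R) : \bar R :=
  match ms with
  | [::] => f (fun _ => 0)
  | m0 :: ms' =>
      (\int[lebesgue_measure]_(t in [set: R])
         ((normal_pdf m0 sigma t)%:E * gint sigma ms' (fun y => f (scons t y))))%E
  end.

Section Model.
Variables (M N : nat) (H : 'M[R]_(M, N)) (sigma : R).

Definition mean_seq (x : 'cV[R]_N) : seq R := [seq (H *m x) i 0 | i <- enum 'I_M].

(* E_x { F(y) } for nonnegative extended-real F *)
Definition gexp (x : 'cV[R]_N) (F : M.-tuple R -> \bar R) : \bar R :=
  gint sigma (mean_seq x) (fun y => F [tuple y i | i < M]).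

Definition integrable_at (x : 'cV[R]_N) (g : M.-tuple R -> R) : Prop :=
  (gexp x (fun y => (`|g y|)%:E) < +oo)%E.

(* E_x { g(y) } (meaningful when integrable_at x g) *)
Definition Emean (x : 'cV[R]_N) (g : M.-tuple R -> R) : R :=
  fine (gexp x (fun y => (Num.max (g y) 0)%:E))
  - fine (gexp x (fun y => (Num.max (- g y) 0)%:E)).

Definition variance (x : 'cV[R]_N) (g : M.-tuple R -> R) : \bar R :=
  gexp x (fun y => ((g y - Emean x g) ^+ 2)%:E).

Definition finite_variance (x : 'cV[R]_N) (g : M.-tuple R -> R) : Prop :=
  integrable_at x g /\ (variance x g < +oo)%E.

Definition min_var (S : nat) (k : 'I_N) (c : 'cV[R]_N -> R) (x0 : 'cV[R]_N) : \bar R :=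
  ereal_inf [set v | exists g : M.-tuple R -> R,
     [/\ measurable_fun [set: M.-tuple R] g,
         finite_variance x0 g,
         (forall x, sparse_set S x -> integrable_at x g /\ Emean x g - x k 0 = c x)
       & v = variance x0 g]].
End Model.
End Defs.

(* Main.v *)
(** Fix an admissible estimator [g] and let [L x] be the likelihood ratio of the
    model at [x] with respect to the model at [x0], so that [E_x g = E_x0 (g L x)]
    and [E_x0 (L x * L y) = exp (<H (x - x0), H (y - x0)> / sigma^2)].
    For any weights [a], the inequality [0 <= E_x0 (g - E_x0 g - D)^2] with
    [D = \sum_i a_i (L (xt + t e_(k_i)) - L xt) / t] bounds the variance of [g] from
    below through the values of [E_x g] at [K]-supported [x], fixed by the bias.
    The residual [v = H xt - H x0] is orthogonal to the columns of [H_K], so letting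
    [t] tend to [0] gives
    [2 b^T a - exp (|v|^2 / sigma^2) / sigma^2 * a^T (H_K^T H_K) a <= v(g; x0)].
    The optimal [a] yields [exp (- |v|^2 / sigma^2) sigma^2 b^T (H_K^T H_K)^-1 b],
    and [v] is the component orthogonal to the range of [H_K] of
    [- H x0^(supp x0 \ K)], whence [|v|^2 <= (1 + dS) |x0^(supp x0 \ K)|^2]. *)

Require Import Defs.
From HB Require Import structures.
From mathcomp Require Import all_boot all_order all_algebra.
From mathcomp Require Import all_classical all_reals all_analysis.
From mathcomp Require Import measurable_realfun giry ring.
Set Implicit Arguments. Unset Strict Implicit. Unset Printing Implicit Defensive.
Import Order.TTheory GRing.Theory Num.Theory.
Local Open Scope classical_set_scope.
Local Open Scope ring_scope.

(** * Inner products, restricted isometry and Gram matrices *)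

Definition dotcv (R : realType) n (u v : 'cV[R]_n) : R := \sum_i u i 0 * v i 0.

Section linear_algebra.
Context (R : realType).

Lemma dotcvC n (u v : 'cV[R]_n) : dotcv u v = dotcv v u.
Proof. by apply: eq_bigr => i _; rewrite mulrC. Qed.

Lemma dotcvDl n (u v w : 'cV[R]_n) : dotcv (u + v) w = dotcv u w + dotcv v w.
Proof. by rewrite /dotcv -big_split; apply: eq_bigr => i _; rewrite mxE mulrDl. Qed.

Lemma dotcvZl n a (u v : 'cV[R]_n) : dotcv (a *: u) v = a * dotcv u v.
Proof. by rewrite /dotcv mulr_sumr; apply: eq_bigr => i _; rewrite mxE mulrA. Qed.

Lemma dotcvDr n (u v w : 'cV[R]_n) : dotcv w (u + v) = dotcv w u + dotcv w v.
Proof. by rewrite dotcvC dotcvDl !(dotcvC w). Qed.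

Lemma dotcvZr n a (u v : 'cV[R]_n) : dotcv v (a *: u) = a * dotcv v u.
Proof. by rewrite dotcvC dotcvZl dotcvC. Qed.

Lemma dotcvE n (u v : 'cV[R]_n) : dotcv u v = (u^T *m v) 0 0.
Proof. by rewrite mxE; apply: eq_bigr => i _; rewrite mxE. Qed.

Lemma sqnormE n (u : 'cV[R]_n) : sqnorm u = dotcv u u.
Proof. by apply: eq_bigr => i _; rewrite expr2. Qed.

Lemma sqnorm_ge0 n (u : 'cV[R]_n) : 0 <= sqnorm u.
Proof. by apply: sumr_ge0 => i _; rewrite sqr_ge0. Qed.

Lemma sqnorm_eq0 n (u : 'cV[R]_n) : sqnorm u = 0 -> u = 0.
Proof.
move=> /eqP; rewrite psumr_eq0 => [|i _]; last by rewrite sqr_ge0.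
move=> /allP u0; apply/colP => i; rewrite mxE.
by apply/eqP; rewrite -sqrf_eq0; exact: (u0 i (mem_index_enum _)).
Qed.

Lemma sqnorm_sub_orthogonal n (u v : 'cV[R]_n) :
  dotcv u v = 0 -> sqnorm (u - v) = sqnorm u + sqnorm v.
Proof.
move=> uv; rewrite !sqnormE -scaleN1r !(dotcvDl, dotcvDr, dotcvZl, dotcvZr).
by rewrite (dotcvC v u) uv; ring.
Qed.

(** Evaluates the exponent of the likelihood kernel at points displaced from [xt]: [u] is the
    residual, [w] and [w'] are columns of [H_K], and a coefficient 0 stands for the undisplaced
    point. *)
Lemma dotcv_shift_orthogonal n (u w w' : 'cV[R]_n) (s t : R) :
  dotcv w u = 0 -> dotcv w' u = 0 ->
  dotcv (u + s *: w) (u + t *: w') = sqnorm u + s * t * dotcv w w'.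
Proof.
move=> wu w'u; rewrite sqnormE !(dotcvDl, dotcvDr, dotcvZl, dotcvZr).
by rewrite wu (dotcvC u w') w'u; ring.
Qed.

Lemma subcols_mul m n (H : 'M[R]_(m, n)) (I : {set 'I_n}) (x : 'cV[R]_n) :
  supp x \subset I ->
  subcols H I *m (\col_i x (@enum_val _ (mem I) i) 0) = H *m x.
Proof.
move=> /fintype.subsetP xI; apply/colP => r; rewrite !mxE [RHS](bigID (mem I))/=.
rewrite [X in _ = _ + X]big1 ?addr0 => [|i iI]; last first.
  case: (eqVneq (x i 0) 0) => [->|xi0]; first by rewrite mulr0.
  by case/negP: iI; apply: xI; rewrite inE.
rewrite [RHS]big_enum_val; apply: eq_bigr => i _.
by rewrite !mxE.
Qed.

Lemma sqnorm_restrict n (I : {set 'I_n}) (x : 'cV[R]_n) :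
  sqnorm (\col_i x (@enum_val _ (mem I) i) 0) = \sum_(i in I) x i 0 ^+ 2.
Proof. by rewrite big_enum_val; apply: eq_bigr => i _; rewrite mxE. Qed.

(** The isometry bounds speak of exactly [S] columns, so smaller supports have to be padded to size
    [S]. *)
Lemma extend_set n (A : {set 'I_n}) S : (#|A| <= S <= n)%N ->
  exists2 I : {set 'I_n}, A \subset I & #|I| = S.
Proof.
move=> /andP[]; elim: S => [|S IH] AS Sn.
  by exists A => //; apply/eqP; rewrite -leqn0.
move: AS; rewrite leq_eqVlt => /predU1P[cA|AS]; first by exists A.
have [I AI cI] := IH AS (ltnW Sn).
have [x xI] : exists x, x \notin I.
  apply/existsP; rewrite -negb_forall; apply: contraL Sn => /forallP IT.
  rewrite -leqNgt -cI (_ : I = finset.setT) ?cardsT ?card_ord//.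
  by apply/finset.setP => i; rewrite IT inE.
exists (x |: I); last by rewrite cardsU1 xI cI.
exact: fintype.subset_trans AI (finset.subsetUr _ _).
Qed.

(** Pad the support of [x] to a set [I] of size [S]; restricting [x] to [I] changes neither its norm
    nor its image. *)
Lemma rip_sparse m n (H : 'M[R]_(m, n)) S d (x : 'cV[R]_n) :
  (S <= n)%N -> rip_bound H S d -> (#|supp x| <= S)%N ->
  (1 - d) * sqnorm x <= sqnorm (H *m x) <= (1 + d) * sqnorm x.
Proof.
move=> Sn [_ rip] xS.
have [|I xI cI] := @extend_set n (supp x) S; first by rewrite xS.
have := rip I cI (\col_i x (@enum_val _ (mem I) i) 0).
rewrite subcols_mul// sqnorm_restrict.
suff -> : \sum_(i in I) x i 0 ^+ 2 = sqnorm x by [].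
rewrite /sqnorm [RHS](bigID (mem I))/= [X in _ = _ + X]big1 ?addr0// => i iI.
case: (eqVneq (x i 0) 0) => [->|xi0]; first by rewrite expr0n.
by case/negP: iI; apply: (fintype.subsetP xI); rewrite inE.
Qed.

(** A row [u] of the left kernel of [A^T A] satisfies [|A u^T|^2 = u A^T A u^T = 0], so injectivity
    forces [u = 0]. *)
Lemma unitmx_gram_inj m n (A : 'M[R]_(m, n)) :
  (forall z : 'cV[R]_n, A *m z = 0 -> z = 0) -> A^T *m A \in unitmx.
Proof.
move=> Ainj; rewrite -row_free_unit -kermx_eq0; apply/eqP/row_matrixP => i.
rewrite row0; set u := row i _.
have uG : u *m (A^T *m A) = 0 by apply/sub_kermxP; exact: row_sub.
apply/trmx_inj; rewrite trmx0; apply/Ainj/sqnorm_eq0.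
rewrite sqnormE dotcvE trmx_mul trmxK -mulmxA.
by rewrite (mulmxA A^T) (mulmxA u) uG mul0mx mxE.
Qed.

End linear_algebra.

(** * Gaussian integrals and change of mean *)

(** The Radon-Nikodym derivative of the normal law and [normal_pdf] have the same integral over
    every measurable set, hence agree almost everywhere. *)
Lemma ge0_integral_normal_prob (R : realType) (m s : R) (f : R -> \bar R) :
  measurable_fun [set: R] f -> (forall x, 0 <= f x)%E ->
  (\int[normal_prob m s]_x f x =
   \int[lebesgue_measure]_x ((normal_pdf m s x)%:E * f x))%E.
Proof.
move=> mf f0; set mu := lebesgue_measure.
have dom : normal_prob m s `<< mu by exact: normal_prob_dominates.
rewrite -(Radon_Nikodym_SigmaFinite.change_of_variables dom)//.
set h := Radon_Nikodym_SigmaFinite.f _ _.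
have ih : mu.-integrable setT h by exact: Radon_Nikodym_SigmaFinite.f_integrable.
have mpdf : measurable_fun [set: R] (fun x => (normal_pdf m s x)%:E).
  by apply/measurable_EFinP; exact: measurable_normal_pdf.
under [RHS]eq_integral do rewrite muleC.
apply: ge0_ae_eq_integral => //.
- by apply: emeasurable_funM => //; exact: measurable_int ih.
- exact: emeasurable_funM.
- by move=> x _; rewrite mule_ge0//; exact: Radon_Nikodym_SigmaFinite.f_ge0.
- by move=> x _; rewrite mule_ge0// lee_fin normal_pdf_ge0.
apply: ae_eqe_mul2l; apply: integral_ae_eq => //= E _ mE.
by rewrite -Radon_Nikodym_SigmaFinite.f_integral.
Qed.

(* The density of N(m', s^2 I) with respect to N(m, s^2 I) at [w]. *)
Definition lratio {R : realType} (s : R) n (m m' : seq R) (w : n.-tuple R) : R :=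
  expR (\sum_(i < n) ((m'`_i - m`_i) * (tnth w i - m`_i) / s ^+ 2
                      - (m'`_i - m`_i) ^+ 2 / (s ^+ 2 *+ 2))).

Lemma measurable_lratio (R : realType) (s : R) n (m m' : seq R) :
  measurable_fun [set: n.-tuple R] (@lratio R s n m m').
Proof.
apply: measurableT_comp => //; apply: measurable_sum => i.
apply: measurable_funB => //; apply: measurable_funM => //.
apply: measurable_funM => //; apply: measurable_funB => //.
exact: measurable_tnth.
Qed.

Lemma lratio_ge0 (R : realType) (s : R) n (m m' : seq R) (w : n.-tuple R) :
  0 <= lratio s m m' w.
Proof. exact: expR_ge0. Qed.

Lemma normal_pdf_lratio (R : realType) (s a b t : R) : s != 0 ->
  normal_pdf b s t = normal_pdf a s t *
    expR ((b - a) * (t - a) / s ^+ 2 - (b - a) ^+ 2 / (s ^+ 2 *+ 2)).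
Proof.
move=> s0; rewrite !normal_pdfE// /normal_fun -[RHS]mulrA -expRD; congr (_ * expR _).
by field.
Qed.

Lemma lratio_cons (R : realType) (s : R) n a m a' m' t (w : n.-tuple R) :
  lratio s (a :: m) (a' :: m') (cons_tuple t w) =
  expR ((a' - a) * (t - a) / s ^+ 2 - (a' - a) ^+ 2 / (s ^+ 2 *+ 2)) *
  lratio s m m' w.
Proof.
rewrite /lratio big_ord_recl expRD/=; congr (expR _ * expR _).
by apply: eq_bigr => i _; rewrite tnthS.
Qed.

Lemma tuple_scons (R : realType) n (t : R) (y : nat -> R) :
  [tuple scons t y i | i < n.+1] = cons_tuple t [tuple y i | i < n].
Proof.
apply: eq_from_tnth => i; case: (unliftP ord0 i) => [j|] ->.
  by rewrite tnthS !tnth_mktuple.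
by rewrite tnth_mktuple.
Qed.

(** [P] is the product Gaussian law with means [m], built one coordinate at a time. It serves for
    all [m'] at once, which turns iterated integrals with different means into integrals over one
    probability space. *)
Lemma gint_lratio (R : realType) (s : R) (m : seq R) : s != 0 ->
  exists P : giry ((size m).-tuple R) R,
  forall m', size m' = size m ->
  forall F : (size m).-tuple R -> \bar R,
    measurable_fun [set: _] F -> (forall w, 0 <= F w)%E ->
    gint s m' (fun y => F [tuple y i | i < size m]) =
    (\int[P]_w (F w * (lratio s m m' w)%:E))%E.
Proof.
move=> s0; elim: m => [|a m [P IH]] /=.
  exists (giry_ret [tuple]) => -[]//= _ F mF F0.
  rewrite [RHS]giry_int_ret; last first.
    apply: emeasurable_funM => //.
    by apply/measurable_EFinP; exact: measurable_lratio.
  rewrite /lratio big_ord0 expR0 mule1; congr F.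
  exact: tuple0.
pose c (z : measurableTypeR R * (size m).-tuple R) : (size m).+1.-tuple R :=
  cons_tuple (z.1 : R) z.2.
have mc : measurable_fun setT c.
  exact: (@measurable_cons _ _ _ R).
(* Law of the tuple obtained by prepending an independent N(a, s^2) coordinate; Tonelli then peels
   it off again. *)
exists (giry_map mc (giry_prod (normal_prob a s : giry _ R, P))).
move=> -[]// a' m' [sm'] F mF F0.
pose h w := (F w * (lratio s (a :: m) (a' :: m') w)%:E)%E.
have mh : measurable_fun setT h.
  apply: emeasurable_funM => //.
  by apply/measurable_EFinP; exact: measurable_lratio.
have h0 w : (0 <= h w)%E by rewrite mule_ge0// lee_fin lratio_ge0.
rewrite [RHS](giry_int_map mc _ mh h0).
rewrite giry_int_prod1//; first last.
- by move=> z; exact: h0.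
- exact: (measurableT_comp mh mc).
rewrite [RHS]ge0_integral_normal_prob//; first last.
- by move=> t; apply: integral_ge0 => w _; exact: h0.
- apply: (measurable_fun_fubini_tonelli_F (m2 := P)
   (h \o c)); last by move=> z; exact: h0.
  exact: (measurableT_comp mh mc).
rewrite [LHS]/=. apply: eq_integral => t _.
under eq_fun do rewrite tuple_scons.
have mFt : measurable_fun setT (fun w : (size m).-tuple R => F (cons_tuple t w)).
  by apply: measurableT_comp => //; exact: measurable_cons.
rewrite (IH m' sm' (fun w => F (cons_tuple t w)))//.
(* Changing the mean of the head coordinate from [a'] to [a] produces exactly the head factor of
   [lratio]. *)
rewrite (normal_pdf_lratio a) // EFinM -muleA; congr (_ * _)%E.
have mFL : measurable_fun setT (fun w : (size m).-tuple R =>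
    (F (cons_tuple t w) * (lratio s m m' w)%:E)%E).
  apply: emeasurable_funM => //.
  by apply/measurable_EFinP; exact: measurable_lratio.
rewrite -ge0_integralZl//; last first.
- by move=> w _; rewrite mule_ge0// lee_fin lratio_ge0.
by apply: eq_integral => w _; rewrite /= /h /c lratio_cons EFinM muleCA.
Qed.

(** * Calculus of integrable functions with known integral *)

(** Integrability and value are bundled so that linear combinations carry both along together. *)
Definition has_Rintegral d (T : measurableType d) (R : realType)
    (mu : {measure set T -> \bar R}) (f : T -> R) (v : R) : Prop :=
  mu.-integrable setT (EFin \o f) /\ \int[mu]_x f x = v.

Section has_Rintegral_theory.
Context d (T : measurableType d) (R : realType) (mu : {measure set T -> \bar R}).
Implicit Types (f g : T -> R) (u v : R).

Lemma eq_has_Rintegral f g u v : f =1 g -> u = v ->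
  has_Rintegral mu f u -> has_Rintegral mu g v.
Proof. by move=> /funext -> ->. Qed.

Lemma has_RintegralB f g u v :
  has_Rintegral mu f u -> has_Rintegral mu g v ->
  has_Rintegral mu (fun x => f x - g x) (u - v).
Proof.
move=> [fi <-] [gi <-]; split; last by rewrite RintegralB.
have := integrableB measurableT fi gi.
by apply: eq_integrable => // x _ /=; rewrite EFinB.
Qed.

Lemma has_RintegralZ a f u : has_Rintegral mu f u ->
  has_Rintegral mu (fun x => a * f x) (a * u).
Proof.
move=> [fi <-]; split; last by rewrite RintegralZl.
have := integrableZl measurableT a fi.
by apply: eq_integrable => // x _ /=; rewrite EFinM.
Qed.

Lemma has_Rintegral_sum (I : Type) (r : seq I) (F : I -> T -> R) (u : I -> R) :
  (forall i, has_Rintegral mu (F i) (u i)) ->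
  has_Rintegral mu (fun x => \sum_(i <- r) F i x) (\sum_(i <- r) u i).
Proof.
move=> FI; elim: r => [|i r [IHi IH]].
  split; last first.
    under eq_Rintegral do rewrite big_nil.
    by rewrite Rintegral_cst// mul0r big_nil.
  apply: (eq_integrable _ (cst 0%E)) => //; last exact: integrable0.
  by move=> x _ /=; rewrite big_nil.
have [Fi Fu] := FI i.
split; last first.
  under eq_Rintegral do rewrite big_cons.
  by rewrite RintegralD// IH Fu big_cons.
have := integrableD measurableT Fi IHi.
by apply: eq_integrable => // x _ /=; rewrite big_cons EFinD.
Qed.

Lemma le_has_Rintegral f g u v :
  has_Rintegral mu f u -> has_Rintegral mu g v ->
  (forall x, f x <= g x) -> u <= v.
Proof. by move=> [fi <-] [gi <-] fg; exact: le_Rintegral. Qed.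

(* Integrate [0 <= (f - \sum_i a i * D i) ^+ 2]. *)
Lemma has_Rintegral_quadratic_le p f (D : 'I_p -> T -> R) V
    (A : 'I_p -> R) (B : 'I_p -> 'I_p -> R) (a : 'I_p -> R) :
  has_Rintegral mu (fun x => f x ^+ 2) V ->
  (forall i, has_Rintegral mu (fun x => f x * D i x) (A i)) ->
  (forall i j, has_Rintegral mu (fun x => D i x * D j x) (B i j)) ->
  2 * (\sum_i a i * A i) - \sum_i \sum_j a i * a j * B i j <= V.
Proof.
move=> fV fA DB.
apply: (@le_has_Rintegral
  (fun x => 2 * (\sum_i a i * (f x * D i x))
            - \sum_i \sum_j a i * a j * (D i x * D j x)) (fun x => f x ^+ 2)) => //.
  apply: has_RintegralB.
    by apply: has_RintegralZ; apply: has_Rintegral_sum => i; exact: has_RintegralZ.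
  by do 2![apply: has_Rintegral_sum => ?]; exact: has_RintegralZ.
move=> x; rewrite -subr_ge0.
set s := \sum_i a i * D i x.
rewrite (_ : \sum_i a i * _ = f x * s); last first.
  by rewrite mulr_sumr; apply: eq_bigr => i _; ring.
rewrite (_ : \sum_i _ = s * s); last first.
  rewrite mulr_suml; apply: eq_bigr => i _.
  by rewrite mulr_sumr; apply: eq_bigr => j _; ring.
by rewrite (_ : _ - _ = (f x - s) ^+ 2) ?sqr_ge0//; ring.
Qed.

End has_Rintegral_theory.

(** * Likelihood ratios of the linear Gaussian model *)

Section gaussian_model.
Context (R : realType) (M N : nat) (H : 'M[R]_(M, N)) (sigma : R).
Hypothesis sigma0 : sigma != 0.
Implicit Types x y : 'cV[R]_N.

Lemma size_mean_seq x : size (mean_seq H x) = M.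
Proof. by rewrite size_map size_enum_ord. Qed.

Lemma nth_mean_seq x (i : 'I_M) : (mean_seq H x)`_i = (H *m x) i 0.
Proof. by rewrite (nth_map i) ?size_enum_ord// nth_ord_enum. Qed.

Definition likelihood x0 x : M.-tuple R -> R :=
  @lratio R sigma M (mean_seq H x0) (mean_seq H x).

(** [P] is the law of the observation at [x0] and is chosen before [x]: expectations at every [x]
    become weighted integrals over it. *)
Lemma gexp_likelihood x0 : exists P : giry (M.-tuple R) R,
  forall x (F : M.-tuple R -> \bar R),
    measurable_fun setT F -> (forall w, 0 <= F w)%E ->
    gexp H sigma x F = (\int[P]_w (F w * (likelihood x0 x w)%:E))%E.
Proof.
have := @gint_lratio R sigma (mean_seq H x0) sigma0.
rewrite /likelihood size_mean_seq => -[P gP]; exists P => x F mF F0.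
by rewrite /gexp gP// size_mean_seq.
Qed.

Lemma gexp_ge0 x (F : M.-tuple R -> \bar R) :
  (forall w, 0 <= F w)%E -> (0 <= gexp H sigma x F)%E.
Proof.
move=> F0; rewrite /gexp; set f := (fun _ => _).
have f0 u : (0 <= f u)%E by exact: F0.
elim: (mean_seq H x) f f0 => [|m ms IH] f f0 /=; first exact: f0.
apply: integral_ge0 => t _; apply: mule_ge0; last exact: IH.
by rewrite lee_fin normal_pdf_ge0.
Qed.

Lemma gexp1 x : gexp H sigma x (fun=> 1%E) = 1%E.
Proof.
rewrite /gexp; elim: (mean_seq _ _) => //= a m IH.
by under eq_integral do rewrite IH mule1; exact: integral_normal_pdf.
Qed.

Lemma likelihoodxx x w : likelihood x x w = 1.
Proof.
rewrite /likelihood /lratio big1 ?expR0// => i _.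
by rewrite subrr expr0n !mul0r subrr.
Qed.

Lemma likelihoodM x0 x y w : likelihood x0 x w * likelihood x0 y w =
  expR (dotcv (H *m x - H *m x0) (H *m y - H *m x0) / sigma ^+ 2)
  * likelihood x0 (x + y - x0) w.
Proof.
rewrite /likelihood /lratio -!expRD; congr expR.
rewrite /dotcv mulr_suml -!big_split/=; apply: eq_bigr => i _.
by rewrite !nth_mean_seq mulmxBr mulmxDr !mxE; field.
Qed.

End gaussian_model.

(** * Variance bound from finitely many test points *)

Section barankin.
Context (R : realType) (M N : nat) (H : 'M[R]_(M, N)) (sigma : R).
Hypothesis sigma0 : sigma != 0.
Variables (x0 : 'cV[R]_N) (P : giry (M.-tuple R) R).
Hypothesis gexpP : forall x (F : M.-tuple R -> \bar R),
  measurable_fun setT F -> (forall w, 0 <= F w)%E ->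
  gexp H sigma x F = (\int[P]_w (F w * (likelihood H sigma x0 x w)%:E))%E.
Local Notation L := (likelihood H sigma x0).

Let measurable_L x : measurable_fun setT (L x).
Proof. exact: measurable_lratio. Qed.

Let L_ge0 x w : 0 <= L x w. Proof. exact: lratio_ge0. Qed.

(** As [L x] is nonnegative, the positive and negative parts of [g * L x] are those of [g] times
    [L x], which matches the two terms of [Emean]. *)
Lemma has_Rintegral_Emean x (g : M.-tuple R -> R) :
  measurable_fun setT g -> integrable_at H sigma x g ->
  has_Rintegral P (fun w => g w * L x w) (Emean H sigma x g).
Proof.
move=> mg gx.
have igL : P.-integrable setT (EFin \o (fun w => g w * L x w)).
  apply/integrableP; split.
    by apply/measurable_EFinP; exact: measurable_funM.
  move: gx; rewrite /integrable_at gexpP//; last first.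
    by apply/measurable_EFinP; exact: measurableT_comp.
  by under eq_integral do rewrite -EFinM -[X in _ * X]ger0_norm// -normrM.
split=> //; rewrite /Emean !gexpP//; first last.
- by move=> w; rewrite lee_fin le_max lexx orbT.
- by apply/measurable_EFinP/measurable_maxr.
- by move=> w; rewrite lee_fin le_max lexx orbT.
- by apply/measurable_EFinP/measurable_maxr => //; exact: measurableT_comp.
rewrite /Rintegral integralE fineB; last 2 first.
- exact: integrable_pos_fin_num.
- exact: integrable_neg_fin_num.
congr (fine _ - fine _); apply: eq_integral => w _.
  by rewrite funeposE /= -EFinM -[0%E]/(0%:E) -EFin_max maxr_pMl// mul0r.
by rewrite funenegE /= -EFinM -[0%E]/(0%:E) -EFin_max maxr_pMl// mul0r mulNr.
Qed.

Lemma has_Rintegral_likelihood x : has_Rintegral P (L x) 1.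
Proof.
have L1 : (\int[P]_w (L x w)%:E = 1)%E.
  rewrite -[RHS](gexp1 H sigma x) gexpP//.
  by apply: eq_integral => w _; rewrite mul1e.
split; last by rewrite /Rintegral L1.
apply/integrableP; split; first exact/measurable_EFinP.
by under eq_integral do rewrite /= ger0_norm//; rewrite L1 ltry.
Qed.

(** The reproducing kernel of the model at [x0], that is, the second moment of likelihood ratios
    under [P]. *)
Definition likelihood_kernel x y : R :=
  expR (dotcv (H *m x - H *m x0) (H *m y - H *m x0) / sigma ^+ 2).

Lemma has_Rintegral_likelihoodM x y :
  has_Rintegral P (fun w => L x w * L y w) (likelihood_kernel x y).
Proof.
apply: (eq_has_Rintegral _ (mulr1 _) (has_RintegralZ
  (likelihood_kernel x y) (has_Rintegral_likelihood (x + y - x0)))) => w.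
by rewrite -likelihoodM.
Qed.

(** The likelihood ratio of [x0] to itself is 1, so the variance at [x0] is a plain integral over
    [P]. *)
Lemma has_Rintegral_variance (g : M.-tuple R -> R) :
  measurable_fun setT g -> finite_variance H sigma x0 g ->
  has_Rintegral P (fun w => (g w - Emean H sigma x0 g) ^+ 2)
    (fine (Defs.variance H sigma x0 g)).
Proof.
move=> mg [_]; set e := Emean _ _ _ _.
have mf : measurable_fun setT (fun w => (g w - e) ^+ 2).
  by apply: measurable_funX; exact: measurable_funB.
rewrite /Defs.variance gexpP//; last 2 first.
- exact/measurable_EFinP.
- by move=> w; rewrite lee_fin sqr_ge0.
under eq_integral do rewrite likelihoodxx mule1.
move=> fin; split=> //.
apply/integrableP; split; first exact/measurable_EFinP.
by under eq_integral do rewrite /= ger0_norm ?sqr_ge0//.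
Qed.

Lemma barankin_density p (g : M.-tuple R -> R) (xb : 'cV[R]_N)
    (xs : 'I_p -> 'cV[R]_N) (a : 'I_p -> R) :
  measurable_fun setT g -> finite_variance H sigma x0 g ->
  integrable_at H sigma xb g -> (forall i, integrable_at H sigma (xs i) g) ->
  2 * (\sum_i a i * (Emean H sigma (xs i) g - Emean H sigma xb g))
  - \sum_i \sum_j a i * a j *
     (likelihood_kernel (xs i) (xs j) - likelihood_kernel (xs i) xb
      - (likelihood_kernel xb (xs j) - likelihood_kernel xb xb))
  <= fine (Defs.variance H sigma x0 g).
Proof.
move=> mg gfin gb gs; set e := Emean H sigma x0 g.
apply: (has_Rintegral_quadratic_le a (D := fun i w => L (xs i) w - L xb w)
  (has_Rintegral_variance mg gfin)) => [i|i j].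
(* The centring constant [e] contributes [e * (1 - 1) = 0], since both likelihood ratios integrate
   to 1. *)
- have := has_RintegralB
    (has_RintegralB (has_Rintegral_Emean mg (gs i)) (has_Rintegral_Emean mg gb))
    (has_RintegralZ e (has_RintegralB (has_Rintegral_likelihood (xs i))
                                      (has_Rintegral_likelihood xb))).
  by apply: eq_has_Rintegral => [w /=|]; rewrite -?/e; ring.
- have := has_RintegralB
    (has_RintegralB (has_Rintegral_likelihoodM (xs i) (xs j))
                    (has_Rintegral_likelihoodM (xs i) xb))
    (has_RintegralB (has_Rintegral_likelihoodM xb (xs j))
                    (has_Rintegral_likelihoodM xb xb)).
  by apply: eq_has_Rintegral => // w /=; ring.
Qed.

End barankin.

(** * Passage from differences to derivatives *)

Section limits.
Import numFieldNormedType.Exports.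
Context (R : realType).
Implicit Types f : R -> R.

Lemma cvg_slope f : derivable f 0 1 ->
  t^-1 * (f t - f 0) @[t --> 0^'] --> f^`()%classic 0.
Proof.
move=> df.
have c : cvg (t^-1 *: (f (t + 0) - f 0) @[t --> 0^']).
  move: df; rewrite /derivable.
  rewrite (_ : (fun h => _) = (fun t => t^-1 *: (f (t + 0) - f 0)))//.
  by apply/funext => h /=; rewrite [_%:A]mulr1.
rewrite (_ : (fun t => _) = (fun t => t^-1 *: (f (t + 0) - f 0)))//.
by apply/funext => t; rewrite addr0.
Qed.

(** Fits the increments of [E_x g = x_k + c x] along a coordinate: the [x_k] part is linear with
    slope a Kronecker delta, the rest comes from the bias. *)
Lemma cvg_slope_affine f (D : R -> R) (k : R) : derivable f 0 1 ->
  (forall t, t != 0 -> D t = k * t + (f t - f 0)) ->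
  t^-1 * D t @[t --> 0^'] --> k + f^`()%classic 0.
Proof.
move=> df DE.
have : k + t^-1 * (f t - f 0) @[t --> 0^'] --> k + f^`()%classic 0.
  by apply: cvgD; [exact: cvg_cst|exact: cvg_slope].
apply: cvg_trans; apply: near_eq_cvg; near=> t.
have t0 : t != 0 by near: t; exact: nbhs_dnbhs_neq.
by rewrite DE//; field.
Unshelve. all: by end_near.
Qed.

Lemma cvg_sum (T I : Type) (F : set_system T) (r : seq I) (f : I -> T -> R)
    (l : I -> R) : Filter F ->
  (forall i, f i t @[t --> F] --> l i) ->
  \sum_(i <- r) f i t @[t --> F] --> \sum_(i <- r) l i.
Proof.
by move=> FF fl; apply: cvg_big => //; exact: add_continuous.
Qed.

(** This is the derivative of [expR (s * q)] at [s = 0], composed with [s = t ^+ 2]. *)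
Lemma cvg_expR_slope (q : R) :
  t^-1 ^+ 2 * (expR (t ^+ 2 * q) - 1) @[t --> 0^'] --> q.
Proof.
pose f (s : R) := expR (s * q).
have df : is_derive (0 : R) 1 f q.
  by apply: is_derive_eq; rewrite mul0r expR0 mul1r scaler0 add0r [_%:A]mulr1.
have := cvg_slope (@ex_derive _ _ _ _ _ _ _ df).
rewrite derive1E (@derive_val _ _ _ _ _ _ _ df) => fq.
(* The limit must stay in the punctured neighbourhood; it does, because [t ^+ 2] vanishes only at
   0. *)
have sq : (t : R) ^+ 2 @[t --> 0^'] --> 0^'.
  rewrite -[X in _ --> X^'](expr0n R 2).
  apply: (@continuous_injective_withinNx R R (fun t : R => t ^+ 2)).
    exact: exprn_continuous.
  by move=> y /eqP; rewrite expr0n /= sqrf_eq0 => /eqP.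
have := cvg_comp _ _ sq fq.
by rewrite /comp /f mul0r expR0; under eq_fun do rewrite -exprVn.
Qed.

(** The weights [a i / t] turn the increments [D i t] into difference quotients and put a factor
    [1/t^2] on the kernel increments, which then tend to [E * q i j]; the non-strict inequality
    survives the limit. *)
Lemma quadratic_limit_le p (D : 'I_p -> R -> R) (d a : 'I_p -> R)
    (q : 'I_p -> 'I_p -> R) (E V : R) :
  (forall i, t^-1 * D i t @[t --> 0^'] --> d i) ->
  (forall t, t != 0 ->
    2 * (\sum_i a i / t * D i t)
    - \sum_i \sum_j a i / t * (a j / t) * (E * (expR (t ^+ 2 * q i j) - 1)) <= V) ->
  2 * (\sum_i a i * d i) - \sum_i \sum_j a i * a j * (E * q i j) <= V.
Proof.
move=> Dd le.
apply: (@cvgr_to_le R 0^' _ R (fun t => 2 * (\sum_i a i * (t^-1 * D i t))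
  - \sum_i \sum_j a i * a j * (E * (t^-1 ^+ 2 * (expR (t ^+ 2 * q i j) - 1))))).
  apply: cvgB.
    apply: cvgM; first exact: cvg_cst.
    by apply: cvg_sum => i; apply: cvgM => //; exact: cvg_cst.
  do 2![apply: cvg_sum => ?]; apply: cvgM; first exact: cvg_cst.
  by apply: cvgM; [exact: cvg_cst|exact: cvg_expR_slope].
near=> t.
have t0 : t != 0 by near: t; exact: nbhs_dnbhs_neq.
apply: le_trans (le t t0); rewrite le_eqVlt; apply/orP; left; apply/eqP.
congr (2 * _ - _); first by apply: eq_bigr => i _; rewrite mulrA.
by apply: eq_bigr => i _; apply: eq_bigr => j _; rewrite exprVn; field.
Unshelve. all: by end_near.
Qed.

End limits.

(** * Projection onto the range of the selected columns *)

Section projection.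
Context (R : realType) (M N S : nat) (H : 'M[R]_(M, N)) (d : R).
Context (K : {set 'I_N}) (Hdag : 'M[R]_(#|K|, M)) (x0 xt : 'cV[R]_N).
Hypothesis SN : (S <= N)%N.
Hypothesis rip : rip_bound H S d.
Hypothesis KS : (#|K| <= S)%N.
Hypothesis x0S : sparse_set S x0.
Hypothesis HdagP : is_pinv (subcols H K) Hdag.
Hypothesis xtK : supp xt \subset K.
Hypothesis xtE : H *m xt = (subcols H K *m Hdag) *m H *m x0.
Local Notation HK := (subcols H K).
Local Notation v := (H *m xt - H *m x0).

(** The projector [P = H_K Hdag] is symmetric and fixes the columns of [H_K], so
    [H_K^T P = H_K^T]. *)
Lemma residual_orthogonal : HK^T *m v = 0.
Proof.
case: HdagP => HHH _ HHt _.
have HtP : HK^T *m HK *m Hdag = HK^T by rewrite -mulmxA -HHt -trmx_mul HHH.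
by rewrite xtE mulmxBr !mulmxA HtP subrr.
Qed.

(** With [d < 1] the lower isometry bound makes [H] injective on vectors supported in [K]. *)
Lemma gram_unit : d < 1 -> HK^T *m HK \in unitmx.
Proof.
move=> d1; apply: unitmx_gram_inj => z Hz0.
(* Extension of [z] by zero outside [K]; each sum has at most one term. *)
pose x : 'cV[R]_N := \col_i \sum_(j | enum_val j == i) z j 0.
have xE j : x (@enum_val _ (mem K) j) 0 = z j 0.
  by rewrite mxE (big_pred1 j)// => k; rewrite (inj_eq enum_val_inj).
have xK : supp x \subset K.
  apply/fintype.subsetP => i; rewrite inE mxE; apply: contraR => iK.
  by rewrite big_pred0// => j; apply: contraNF iK => /eqP <-; exact: enum_valP.
have zE : z = \col_j x (@enum_val _ (mem K) j) 0.
  by apply/colP => j; rewrite mxE xE.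
have /andP[+ _] := rip_sparse SN rip (leq_trans (subset_leq_card xK) KS).
rewrite -(subcols_mul _ xK) -zE Hz0 [sqnorm 0]big1; last first.
  by move=> i _; rewrite mxE expr0n.
rewrite pmulr_rle0 ?subr_gt0// => x_le0.
have x_0 : x = 0 by apply/sqnorm_eq0/le_anti; rewrite x_le0 sqnorm_ge0.
by apply/colP => j; rewrite -xE x_0 !mxE.
Qed.

(** With [x'] the part of [x0] outside [K], [H x'] is a vector in the range of [H_K] minus [v].
    These are orthogonal, so [|v|^2 <= |H x'|^2], and the upper isometry bound applies to [x']. *)
Lemma sqnorm_residual :
  sqnorm v <= (1 + d) * \sum_(i in supp x0 :\: K) x0 i 0 ^+ 2.
Proof.
pose x' : 'cV[R]_N := \col_i (if i \in supp x0 :\: K then x0 i 0 else 0).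
have x'S : (#|supp x'| <= S)%N.
  apply: leq_trans x0S; apply/subset_leq_card/fintype.subsetP => i.
  by rewrite !inE mxE !inE; case: (x0 i 0 =P 0) => [->|]; rewrite ?if_same ?eqxx.
(* [x0 - x'] is the restriction of [x0] to [K], so [H] sends this vector into the range of [H_K]. *)
have yK : supp (xt - (x0 - x')) \subset K.
  apply/fintype.subsetP => i; rewrite inE; apply: contraR => iK.
  have xti : xt i 0 = 0.
    by apply/eqP; move/fintype.subsetP/(_ i)/contra/(_ iK): xtK; rewrite inE negbK.
  rewrite !mxE xti !inE iK /=.
  by case: (x0 i 0 =P 0) => [->|]; rewrite /= ?subrr ?subr0 ?oppr0 ?addr0.
pose z : 'cV[R]_#|K| := \col_j (xt - (x0 - x')) (@enum_val _ (mem K) j) 0.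
have Hx' : H *m x' = HK *m z - v.
  by rewrite /z subcols_mul// !mulmxBr; apply/colP => i; rewrite !mxE; ring.
have zv : dotcv (HK *m z) v = 0.
  by rewrite dotcvE trmx_mul -mulmxA residual_orthogonal mulmx0 mxE.
have /andP[_] := rip_sparse SN rip x'S.
have -> : sqnorm x' = \sum_(i in supp x0 :\: K) x0 i 0 ^+ 2.
  rewrite [RHS]big_mkcond; apply: eq_bigr => i _.
  by rewrite mxE; case: ifP => //; rewrite expr0n.
apply: le_trans.
by rewrite Hx' (sqnorm_sub_orthogonal zv) lerDr sqnorm_ge0.
Qed.

End projection.

(** * The lower bound on the minimum variance *)

Theorem theorem9 (R : realType) (M N S : nat) (H : 'M[R]_(M, N)) (sigma dS : R)
  (k : 'I_N) (x0 : 'cV[R]_N) (K : {set 'I_N})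
  (Hdag : 'M[R]_(#|K|, M)) (xt : 'cV[R]_N) (c : 'cV[R]_N -> R) :
  (1 <= S <= N)%N -> (M <= N)%N -> 0 < sigma ->
  rip_const H S dS -> dS < 1 ->
  sparse_set S x0 -> (#|K| <= S)%N ->
  is_pinv (subcols H K) Hdag ->
  supp xt \subset K -> H *m xt = (subcols H K *m Hdag) *m H *m x0 ->
  (forall l, l \in K -> derivable (fun t : R => c (xt + t *: delta_mx l 0)) 0 1) ->
  let b : 'cV[R]_#|K| := \col_i
      ((k == @enum_val _ (mem K) i)%:R
       + derive1 (fun t : R => c (xt + t *: delta_mx (@enum_val _ (mem K) i) 0)) 0) in
  let HK := subcols H K in
  ((expR (- ((1 + dS) / sigma ^+ 2) * \sum_(i in supp x0 :\: K) (x0 i 0) ^+ 2)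
     * sigma ^+ 2 * (b^T *m invmx (HK^T *m HK) *m b) 0 0)%:E
   <= min_var H sigma S k c x0)%E.
Proof.
move=> /andP[_ SN] _ sigma_gt0 [rip _] dS1 x0S KS HdagP xtK xtE dc.
lazy zeta; set b := (X in X^T); set HK := subcols H K.
have sigma0 : sigma != 0 by rewrite gt_eqF.
have [P gexpP] := gexp_likelihood H sigma0 x0.
have orth := residual_orthogonal HdagP xtE.
have Gu := gram_unit SN rip KS dS1.
rewrite -/HK in orth Gu.
apply: le_ereal_inf_tmp => _ [g [mg gfin gbias ->]].
set V := Defs.variance _ _ _ _.
have V0 : (0 <= V)%E by apply: gexp_ge0 => w; rewrite lee_fin sqr_ge0.
rewrite -[V]fineK; last by rewrite ge0_fin_numE//; case: gfin.
rewrite lee_fin.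
pose ev (i : 'I_#|K|) : 'I_N := @enum_val _ (mem K) i.
pose xs t i : 'cV[R]_N := xt + t *: delta_mx (ev i) 0.
(* The test points are supported in [K] and hence [S]-sparse, so the mean of [g] is prescribed at
   each of them. *)
have xsS t i : sparse_set S (xs t i).
  apply: leq_trans KS; apply/subset_leq_card/fintype.subsetP => j.
  rewrite inE; apply: contraR => jK; rewrite !mxE.
  have /eqP -> : xt j 0 == 0.
    by move/fintype.subsetP/(_ j)/contra/(_ jK): xtK; rewrite inE negbK.
  case: (j =P ev i) => [jE|_]; last by rewrite /= mulr0 addr0.
  by case/negP: jK; rewrite jE; exact: enum_valP.
have xtS : sparse_set S xt by apply: leq_trans KS; exact: subset_leq_card.
pose v := H *m xt - H *m x0.
pose h i := H *m delta_mx (ev i) 0 : 'cV[R]_M.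
have hE i r : h i r 0 = HK r i by rewrite /h -colE !mxE.
have hv i : dotcv (h i) v = 0.
  have := congr1 (fun A : 'cV[R]_#|K| => A i 0) orth.
  rewrite !mxE => oi; rewrite -[RHS]oi.
  by apply: eq_bigr => r _; rewrite hE [in RHS]mxE.
have hh i j : dotcv (h i) (h j) = (HK^T *m HK) i j.
  by rewrite mxE; apply: eq_bigr => r _; rewrite !hE [in RHS]mxE.
pose E := expR (sqnorm v / sigma ^+ 2).
pose q i j := dotcv (h i) (h j) / sigma ^+ 2.
pose D i t := Emean H sigma (xs t i) g - Emean H sigma xt g.
have bound (a : 'I_#|K| -> R) :
    2 * (\sum_i a i * b i 0) - \sum_i \sum_j a i * a j * (E * q i j) <= fine V.
  apply: (@quadratic_limit_le _ _ D) => [i|t t0].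
    have di := dc _ (enum_valP i).
    rewrite mxE; apply: (cvg_slope_affine di) => t _.
    (* The bias condition at both points replaces the increment of the mean by that of [x_k + c]. *)
    have [_ bt] := gbias xt xtS; have [_ bs] := gbias (xs t i) (xsS t i).
    rewrite scale0r addr0 -/(ev i) -/(xs t i) -bt -bs !mxE eqxx andbT /D.
    by rewrite mulrC; ring.
  have [igt bt] := gbias xt xtS.
  have igs i := (gbias (xs t i) (xsS t i)).1.
  have := barankin_density sigma0 gexpP (fun i => a i / t) mg gfin igt igs.
  apply: le_trans; rewrite le_eqVlt; apply/orP; left; apply/eqP.
  congr (_ - _); apply: eq_bigr => i _; apply: eq_bigr => j _; congr (_ * _).
  have Hxs i' : H *m xs t i' - H *m x0 = v + t *: h i'.
    by rewrite mulmxDr -scalemxAr addrAC.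
  (* Giving the undisplaced point a coefficient 0 brings all four kernel values to one form: the
     three involving [xt] equal [E], and the second difference is
     [E * (expR (t ^+ 2 * q i j) - 1)]. *)
  have Hxt i' : H *m xt - H *m x0 = v + 0 *: h i' by rewrite scale0r addr0.
  rewrite /likelihood_kernel !Hxs {1 3}(Hxt j) (Hxt i) !dotcv_shift_orthogonal//.
  rewrite !(mul0r, mulr0, addr0) mulrDl expRD /E /q expr2 mulrA; ring.
set G := HK^T *m HK; set beta := (b^T *m _ *m b) 0 0.
pose y := invmx G *m b.
have yb : \sum_i y i 0 * b i 0 = beta.
  by rewrite /beta -mulmxA mxE; apply: eq_bigr => i _; rewrite [in RHS]mxE mulrC.
have yGy : \sum_i \sum_j y i 0 * y j 0 * G i j = beta.
  rewrite -yb; apply: eq_bigr => i _.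
  have -> : b i 0 = \sum_j G i j * y j 0 by rewrite -{1}(mulKVmx Gu b) mxE.
  by rewrite mulr_sumr; apply: eq_bigr => j _; ring.
(* [beta] is [|H_K y|^2]; its sign allows the final comparison of the factors in front of it. *)
have beta_ge0 : 0 <= beta.
  rewrite -yb (_ : \sum_i _ = sqnorm (HK *m y)) ?sqnorm_ge0//.
  rewrite sqnormE dotcvE trmx_mul -mulmxA [HK^T *m _]mulmxA mulKVmx// mxE.
  by apply: eq_bigr => i _; rewrite [in RHS]mxE.
have s2 : 0 < sigma ^+ 2 by rewrite exprn_gt0.
have E_neq0 : E != 0 by rewrite gt_eqF ?expR_gt0.
(* The maximiser of the concave quadratic in [a], where [E / sigma ^+ 2] times [G a] equals [b]; the
   quadratic term is then half of the linear one. *)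
have := bound (fun i => sigma ^+ 2 / E * y i 0).
rewrite (_ : \sum_i _ = sigma ^+ 2 / E * beta); last first.
  rewrite -yGy !mulr_sumr; apply: eq_bigr => i _.
  rewrite !mulr_sumr; apply: eq_bigr => j _; rewrite /q hh -/G /=.
  by field; rewrite E_neq0.
rewrite (_ : \sum_i _ = sigma ^+ 2 / E * beta); last first.
  by rewrite -yb mulr_sumr; apply: eq_bigr => i _; rewrite mulrA.
apply: le_trans; rewrite (_ : 2 * _ - _ = sigma ^+ 2 / E * beta); last by ring.
rewrite ler_wpM2r// mulrC; apply: (ler_wpM2l (ltW s2)).
(* Comparing exponents leaves only the bound on the squared norm of the residual. *)
rewrite /E -expRN ler_expR.
rewrite mulNr lerN2 mulrAC ler_pdivrMr// divfK ?gt_eqF//.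
exact: (sqnorm_residual SN rip x0S HdagP xtK xtE).
Qed.
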